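(* Let $G$ be a graph of order $n_0$ and size $m_0$ such that $d_u+d_v\ge 6$ for every edge $uv$ of $G$. Then for every $k\ge 2$ the iterated line graph $\mathcal{L}^k(G)$ has property $\varrho$, and its energy is $\mathcal{E}(\mathcal{L}^k(G))=4(n_k-n_{k-1})$. Consequently, for each $k\ge 2$, the graphs $\mathcal{L}^k(G)$ arising from all such graphs $G$ (with the same values $n_k,n_{k-1}$) are mutually equienergetic.
   Context: $d_u$ is the degree of $u$ in $G$. The line graph $\mathcal{L}(X)$ has the edges of $X$ as vertices, two adjacent iff the edges share an endpoint; $\mathcal{L}^0(G)=G$, $\mathcal{L}^k(G)=\mathcal{L}(\mathcal{L}^{k-1}(G))$. $n_k,m_k$ denote the order and size of $\mathcal{L}^k(G)$ (so $n_k=m_{k-1}$). A graph has property $\varrho$ if all its negative adjacency eigenvalues are equal to $-2$. The energy $\mathcal{E}(X)$ is the sum of absolute values of the adjacency eigenvalues of $X$; graphs of the same order are equienergetic if their energies are equal. *)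

(* Defs.v *)
From HB Require Import structures.
From mathcomp Require Import all_boot all_order all_algebra.

Set Implicit Arguments.
Unset Strict Implicit.
Unset Printing Implicit Defensive.

Import Order.TTheory GRing.Theory Num.Theory.

Record sgraph : Type := SGraph {
  vertex :> finType;
  adj : rel vertex;
  adj_sym : symmetric adj;
  adj_irr : irreflexive adj
}.
Arguments adj {s}.

Definition deg (G : sgraph) (u : G) : nat := #|[set v | adj u v]|.

Definition edges (G : sgraph) : {set {set G}} :=
  [set e | [exists u, exists v, adj u v && (e == [set u; v])]].

Definition gorder (G : sgraph) : nat := #|G|.

Definition gsize (G : sgraph) : nat := #|edges G|.

Section LineGraph.
Variable G : sgraph.

Definition line_vertex : finType := {e : {set G} | e \in edges G}.

Definition line_adj : rel line_vertex :=
  [rel e f | (e != f) && (val e :&: val f != set0)].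

Lemma line_adj_sym : symmetric line_adj.
Proof. by move=> e f; rewrite /line_adj /= eq_sym setIC. Qed.

Lemma line_adj_irr : irreflexive line_adj.
Proof. by move=> e; rewrite /line_adj /= eqxx. Qed.

Definition line_graph : sgraph := SGraph line_adj_sym line_adj_irr.

Lemma order_line_graph : gorder line_graph = gsize G.
Proof. by rewrite /gorder card_sig. Qed.

End LineGraph.

Definition iter_line (k : nat) (G : sgraph) : sgraph := iter k line_graph G.

Section Spectrum.
Local Open Scope ring_scope.
Variable C : numClosedFieldType.

Definition adj_mx (G : sgraph) : 'M[C]_#|G| :=
  \matrix_(i, j) (adj (enum_val i) (enum_val j))%:R.

(* The roots of the characteristic polynomial, listed with multiplicity. *)
Definition spectrum (G : sgraph) : seq C :=
  sval (closed_field_poly_normal (char_poly (adj_mx G))).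

Lemma spectrumP (G : sgraph) :
  char_poly (adj_mx G) = \prod_(x <- spectrum G) ('X - x%:P).
Proof.
rewrite /spectrum; case: closed_field_poly_normal => s /= {1}->.
by rewrite (monicP (char_poly_monic _)) scale1r.
Qed.

Lemma mem_spectrum (G : sgraph) (x : C) :
  (x \in spectrum G) = eigenvalue (adj_mx G) x.
Proof. by rewrite eigenvalue_root_char spectrumP root_prod_XsubC. Qed.

(* In C, [x < 0] entails that x is real. *)
Definition property_rho (G : sgraph) : Prop :=
  forall x : C, eigenvalue (adj_mx G) x -> x < 0 -> x = - 2%:R.

Definition energy (G : sgraph) : C := \sum_(x <- spectrum G) `|x|.

Definition equienergetic (G H : sgraph) : Prop :=
  gorder G = gorder H /\ energy G = energy H.

End Spectrum.

(* Main.v *)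
(** Put H = L(G) and let N be the incidence matrix of H, with n rows and m
    columns. Then N^T N = A(L(H)) + 2 and N N^T = A(H) + D(H), so comparing
    characteristic polynomials shows that the spectrum of L(H) together with
    n copies of -2 is the spectrum of N N^T - 2 together with m copies of -2.
    Since H is a line graph, A(H) + 2 is positive semidefinite, and the degree
    condition on G gives D(H) >= 4; hence N N^T - 2 is positive semidefinite,
    and every negative eigenvalue of L(H) is -2. Comparing the sums of x and
    of |x| over the two multisets, with tr A(L(H)) = 0, yields the energy
    4(m - n). The degree condition passes to line graphs, so this applies to
    all further iterates. *)

Require Import Defs.
From mathcomp Require Import all_boot all_order all_algebra.
From mathcomp Require Import ring.
Import Order.TTheory GRing.Theory Num.Theory.

Set Implicit Arguments.
Unset Strict Implicit.
Unset Printing Implicit Defensive.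

(** * Incidence counts and degrees in line graphs *)

Lemma edgesP (G : sgraph) (e : {set G}) :
  reflect (exists u v, adj u v /\ e = [set u; v]) (e \in edges G).
Proof.
rewrite inE; apply: (iffP existsP) => [[u /existsP[v /andP[uv /eqP->]]]|].
  by exists u, v.
by case=> u [v [uv ->]]; exists u; apply/existsP; exists v; rewrite uv eqxx.
Qed.

Lemma card_edge (G : sgraph) (e : {set G}) : e \in edges G -> #|e| = 2.
Proof.
case/edgesP=> u [v [uv ->]]; rewrite cards2.
by case: eqVneq uv => // ->; rewrite adj_irr.
Qed.

(** The map [w |-> [set u; w]] is a bijection from the neighbours of [u] onto the edges at [u]. *)
Lemma sum_edges_at (G : sgraph) (u : G) (F : {set G} -> nat) :
  \sum_(e : line_graph G) (u \in val e) * F (val e) =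
  \sum_(w | adj u w) F [set u; w].
Proof.
have inj_pair : {in [pred w | adj u w] &, injective (fun w => [set u; w])}.
  move=> w w' /= uw uw' /setP /(_ w); rewrite !inE eqxx orbT => /esym.
  by case/orP=> /eqP // wu; rewrite wu inE adj_irr in uw.
transitivity (\sum_(e in edges G | u \in e) F e).
  rewrite big_mkcondr [RHS]big_sub.
  by apply: eq_bigr => e _; case: (u \in val e); rewrite ?mul1n.
rewrite -(big_imset F inj_pair) /=; apply: eq_bigl => e.
apply/andP/imsetP => [[/edgesP[a [b [ab ->]]]]|[w uw ->]].
  rewrite !inE => /orP[] /eqP ->; first by exists b.
  by exists a; rewrite ?inE 1?adj_sym // setUC.
by split; [apply/edgesP; exists u, w | rewrite set21].
Qed.

Lemma sum_common_edges (G : sgraph) (u v : G) :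
  \sum_(e : line_graph G) (u \in val e) * (v \in val e) =
  adj u v + (u == v) * deg u.
Proof.
rewrite (sum_edges_at u (fun e => v \in e : nat)).
have [<-|uv] := eqVneq u v.
  rewrite adj_irr add0n mul1n /deg -sum1dep_card.
  by apply: eq_bigr => w _; rewrite !inE eqxx.
rewrite addn0 big_mkcond (bigD1 v) //= big1 ?addn0 => [|w wv].
  by rewrite !inE eqxx orbT; case: adj.
by rewrite !inE eq_sym (negPf uv) eq_sym (negPf wv); case: adj.
Qed.

Lemma sum_common_vertices (G : sgraph) (e f : line_graph G) :
  \sum_(u : G) (u \in val e) * (u \in val f) = adj e f + (e == f) * 2.
Proof.
transitivity #|val e :&: val f|.
  rewrite -sum1_card [RHS]big_mkcond; apply: eq_bigr => u _.
  by rewrite inE; case: (u \in val e); case: (u \in val f).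
have [<-|ef] := eqVneq e f.
  by rewrite setIid adj_irr (card_edge (valP e)).
have -> : adj e f = (0 < #|val e :&: val f|).
  by rewrite card_gt0; apply: andb_idl => _; exact: ef.
rewrite addn0.
(* Two common vertices would force [val e] to lie in [val f], hence [e = f], as both have two
   elements. *)
have: #|val e :&: val f| < 2.
  rewrite -(card_edge (valP e)) proper_card // properE subsetIl subsetI subxx /=.
  apply: contra ef => ef; apply/eqP/val_inj/eqP.
  by rewrite eqEcard ef (card_edge (valP e)) (card_edge (valP f)).
by case: #|_| => [|[|]].
Qed.

(** Count pairs of an edge [f] and a common vertex of [e] and [f]: each neighbour of [e] gives one
    pair and [e] itself gives two, while each end [u] of [e] lies on [deg u] edges. *)
Lemma deg_line_graph (G : sgraph) (e : line_graph G) :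
  deg e + 2 = \sum_(u in val e) deg u.
Proof.
have -> : deg e + 2 = \sum_(f : line_graph G) (adj e f + (e == f) * 2).
  rewrite big_split /= /deg -sum1dep_card big_mkcond /=; congr (_ + _).
  by rewrite (bigD1 e) //= eqxx big1 // => f; rewrite eq_sym => /negPf->.
under eq_bigr do rewrite -sum_common_vertices.
rewrite exchange_big [RHS]big_mkcond; apply: eq_bigr => u _ /=.
case: (u \in val e); last by rewrite big1.
have := sum_common_edges u u; rewrite adj_irr eqxx mul1n add0n => <-.
by apply: eq_bigr => f _; case: (u \in val f).
Qed.

Lemma deg_line_graph_ge4 (G : sgraph) :
  (forall u v : G, adj u v -> 6 <= deg u + deg v) ->
  forall e : line_graph G, 4 <= deg e.
Proof.
move=> deg6 e; rewrite -(leq_add2r 2) deg_line_graph.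
have /edgesP[u [v [uv Ee]]] := valP e; rewrite Ee big_setU1 ?big_set1 ?deg6 //.
by rewrite inE; apply: contraTneq uv => ->; rewrite adj_irr.
Qed.

Lemma iter_line_deg_edge (G : sgraph) (k : nat) :
  (forall u v : G, adj u v -> 6 <= deg u + deg v) ->
  forall u v : iter_line k G, adj u v -> 6 <= deg u + deg v.
Proof.
move=> deg6; elim: k => // k IHk u v _.
have deg4 := deg_line_graph_ge4 IHk.
by apply: (@leq_trans (4 + 4)) => //; exact: leq_add (deg4 u) (deg4 v).
Qed.

Local Open Scope ring_scope.

(* Both sides are the determinant of [x, A; B, 1] times x^n, computed by
   clearing the lower-left block and the upper-right block respectively. *)
Lemma det_scalar_sub_mulmxC (R : comNzRingType) (m n : nat) (x : R)
    (A : 'M[R]_(m, n)) (B : 'M[R]_(n, m)) :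
  x ^+ n * \det (x%:M - A *m B) = x ^+ m * \det (x%:M - B *m A).
Proof.
pose M := block_mx x%:M A B 1%:M.
have detM : \det M = \det (x%:M - A *m B).
  have := det_mulmx M (block_mx 1%:M 0 (- B) 1%:M).
  rewrite det_lblock !det1 !mulr1 => <-; rewrite mulmx_block.
  rewrite !mulmx1 !mul1mx !mulmx0 !mulmxN subrr !add0r det_ublock.
  by rewrite det1 mulr1.
have := det_mulmx M (block_mx 1%:M (- A) 0 x%:M).
rewrite mulmx_block !mulmx1 !mulmx0 !mulmxN !mul1mx !addr0 addrC.
rewrite mul_mx_scalar mul_scalar_mx subrr det_lblock det_ublock.
by rewrite det1 mul1r !det_scalar detM addrC => ->; rewrite mulrC.
Qed.

(** * Positive semidefinite matrices and their eigenvalues *)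

Section PositiveSemidefinite.
Variables (C : numClosedFieldType) (n : nat).
Implicit Types (v : 'rV[C]_n) (M : 'M[C]_n).

(** Row vectors match the left eigenvectors behind [eigenvalue]; in [C], [0 <= z] includes that [z]
    is real. *)
Definition psd M := forall v, 0 <= (v *m M *m (map_mx Num.conj v)^T) 0 0.

Lemma psdD M N : psd M -> psd N -> psd (M + N).
Proof. by move=> M0 N0 v; rewrite mulmxDr mulmxDl mxE addr_ge0. Qed.

Lemma psd_mulmx_conj (m : nat) (A : 'M[C]_(n, m)) :
  psd (A *m (map_mx Num.conj A)^T).
Proof.
move=> v; rewrite mulmxA -mulmxA -trmx_mul -map_mxM mxE sumr_ge0 // => i _.
by rewrite !mxE mul_conjC_ge0.
Qed.

Lemma psd_diag (d : 'rV[C]_n) : (forall i, 0 <= d 0 i) -> psd (diag_mx d).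
Proof.
move=> d0 v; rewrite mul_mx_diag mxE sumr_ge0 // => i _.
by rewrite !mxE mulrAC mulr_ge0 // mul_conjC_ge0.
Qed.

Lemma psd_eigenvalue_ge0 M (a : C) : psd M -> eigenvalue M a -> 0 <= a.
Proof.
move=> M0 /eigenvalueP[v vM v0]; have := M0 v; rewrite vM -scalemxAl mxE.
rewrite pmulr_lge0 // mxE.
have [i vi] : exists i, v 0 i != 0 by apply/rV0Pn.
rewrite (bigD1 i) //= ltr_pwDl ?sumr_ge0 // => [|j _]; rewrite !mxE.
  by rewrite mul_conjC_gt0.
by rewrite mul_conjC_ge0.
Qed.

End PositiveSemidefinite.

(** The sum of the roots is the trace of the adjacency matrix, whose diagonal is zero. *)
Lemma sum_spectrum (C : numClosedFieldType) (G : sgraph) :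
  \sum_(x <- spectrum C G) x = 0.
Proof.
have sz : size (spectrum C G) = #|G|.
  by apply/eq_add_S; rewrite -(size_prod_XsubC _ id) -spectrumP size_char_poly.
have [G0|G_gt0] := posnP #|G|.
  by move: sz; rewrite G0 => /size0nil ->; rewrite big_nil.
apply: oppr_inj; rewrite -coefPn_prod_XsubC ?sz -?lt0n // -spectrumP.
rewrite char_poly_trace // oppr0; apply/eqP; rewrite oppr_eq0; apply/eqP.
by apply: big1 => i _; rewrite mxE adj_irr.
Qed.

(** * Incidence matrix and the spectrum of a line graph *)

Section LineGraphSpectrum.
Variable C : numClosedFieldType.
Implicit Type G : sgraph.

Lemma sum_enum_val_nat (T : finType) (F : T -> nat) :
  \sum_(i < #|T|) (F (enum_val i))%:R = (\sum_x F x)%N%:R :> C.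
Proof. by rewrite -natr_sum [in RHS](big_enum_val F). Qed.

Definition incidence_mx G : 'M[C]_(#|G|, #|line_graph G|) :=
  \matrix_(i, j) (enum_val i \in val (enum_val j : line_graph G))%:R.

Lemma incidence_mx_conj G :
  map_mx Num.conj (incidence_mx G) = incidence_mx G.
Proof. by apply/matrixP=> i j; rewrite !mxE conjC_nat. Qed.

Lemma incidence_mx_tr_mul G :
  (incidence_mx G)^T *m incidence_mx G = adj_mx C (line_graph G) + 2%:M.
Proof.
apply/matrixP=> i j; rewrite !mxE.
under eq_bigr do rewrite !mxE -natrM.
pose ei : line_graph G := enum_val i; pose ej : line_graph G := enum_val j.
rewrite (sum_enum_val_nat (fun u => (u \in val ei) * (u \in val ej))%N).
by rewrite sum_common_vertices natrD (inj_eq enum_val_inj); case: eqP.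
Qed.

Lemma incidence_mx_mul_tr G :
  incidence_mx G *m (incidence_mx G)^T =
  adj_mx C G + diag_mx (\row_i (deg (enum_val i))%:R).
Proof.
apply/matrixP=> i j; rewrite !mxE.
under eq_bigr do rewrite !mxE -natrM.
pose u := enum_val i; pose v := enum_val j.
rewrite (sum_enum_val_nat
  (fun e : line_graph G => (u \in val e) * (v \in val e))%N).
rewrite sum_common_edges natrD (inj_eq enum_val_inj).
by case: eqP => // _; rewrite mul1n.
Qed.

Definition signless_laplacian_sub2 G : 'M[C]_#|G| :=
  incidence_mx G *m (incidence_mx G)^T - 2%:M.

(** With [A] and [D] the adjacency and degree matrices of [line_graph G], write [A + D - 2] as
    [(A + 2) + (D - 4)]: a Gram matrix plus a nonnegative diagonal one. *)
Lemma psd_signless_laplacian_sub2_line_graph G :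
  (forall u v : G, adj u v -> (6 <= deg u + deg v)%N) ->
  psd (signless_laplacian_sub2 (line_graph G)).
Proof.
move=> deg6; pose N := (incidence_mx G)^T.
have NN : N *m (map_mx Num.conj N)^T = adj_mx C (line_graph G) + 2%:M.
  by rewrite map_trmx trmxK incidence_mx_conj incidence_mx_tr_mul.
pose d : 'rV[C]_#|line_graph G| := \row_i (deg (enum_val i) - 4)%:R.
suff -> : signless_laplacian_sub2 (line_graph G) =
          N *m (map_mx Num.conj N)^T + diag_mx d.
  by apply/psdD/psd_diag => [|i]; [exact: psd_mulmx_conj | rewrite mxE ler0n].
rewrite NN /signless_laplacian_sub2 incidence_mx_mul_tr -!addrA; congr (_ + _).
(* The truncated subtraction in [d] is exact because all degrees are at least 4. *)
apply/matrixP=> i j; rewrite !mxE natrB; last exact: deg_line_graph_ge4.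
case: eqP => _; rewrite ?mulr0n ?mulr1n ?subr0 ?addr0 //.
ring.
Qed.

Lemma char_poly_line_graph G :
  ('X + 2%:P) ^+ #|G| * char_poly (adj_mx C (line_graph G)) =
  ('X + 2%:P) ^+ #|line_graph G| * char_poly (signless_laplacian_sub2 G).
Proof.
have charE n (M : 'M[C]_n) :
    char_poly (M - 2%:M) = \det (('X + 2%:P)%:M - map_mx polyC M).
  rewrite /char_poly /char_poly_mx map_mxB map_scalar_mx opprB addrA.
  by rewrite -[in LHS](raddfD (@scalar_mx _ n)).
have -> : adj_mx C (line_graph G) =
          (incidence_mx G)^T *m incidence_mx G - 2%:M.
  by rewrite incidence_mx_tr_mul addrK.
by rewrite !charE !map_mxM; exact: det_scalar_sub_mulmxC.
Qed.

(** Copies of -2 stay on both sides, which avoids comparing the order and size of [G]. *)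
Lemma perm_spectrum_line_graph G (s : seq C) :
  char_poly (signless_laplacian_sub2 G) = \prod_(x <- s) ('X - x%:P) ->
  perm_eq (nseq #|G| (- 2%:R) ++ spectrum C (line_graph G))
          (nseq #|line_graph G| (- 2%:R) ++ s).
Proof.
move=> Es; have := char_poly_line_graph G; rewrite Es spectrumP => E.
apply: prod_XsubC_eq; rewrite !big_cat !big_nseq -!Monoid.iteropE /= polyCN opprK.
exact: E.
Qed.

Lemma line_graph2_rho_energy G :
  (forall u v : G, adj u v -> (6 <= deg u + deg v)%N) ->
  property_rho C (line_graph (line_graph G)) /\
  energy C (line_graph (line_graph G)) =
    4%:R * ((gorder (line_graph (line_graph G)))%:R
            - (gorder (line_graph G))%:R).
Proof.
move=> deg6; set H := line_graph G.
have [s Es] := closed_field_poly_normal (char_poly (signless_laplacian_sub2 H)).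
rewrite (monicP (char_poly_monic _)) scale1r in Es.
have s_ge0 x : x \in s -> 0 <= x.
  rewrite -root_prod_XsubC -Es -eigenvalue_root_char.
  exact/psd_eigenvalue_ge0/psd_signless_laplacian_sub2_line_graph.
have perm_s := perm_spectrum_line_graph Es; split=> [x|].
  rewrite -mem_spectrum => xs x_lt0.
  have: x \in nseq #|line_graph H| (- 2%:R) ++ s.
    by rewrite -(perm_mem perm_s) mem_cat xs orbT.
  rewrite mem_cat => /orP[/nseqP[] //|/s_ge0 x_ge0].
  by rewrite (le_gtF x_ge0) in x_lt0.
have sum_abs : \sum_(x <- s) `|x| = \sum_(x <- s) x.
  by rewrite !big_seq; apply: eq_bigr => x /s_ge0/ger0_norm.
have sumE (F : C -> C) :
    F (- 2%:R) *+ #|H| + \sum_(x <- spectrum C (line_graph H)) F x =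
    F (- 2%:R) *+ #|line_graph H| + \sum_(x <- s) F x.
  have := perm_big _ perm_s : \sum_(x <- _) F x = \sum_(x <- _) F x.
  by rewrite !big_cat !big_nseq !iter_addr_0.
(* The two sums give [-2n = -2m + S] and [2n + E = 2m + S], so [S = 2(m - n)] and [E = 4(m - n)]. *)
have := sumE id; have := sumE Num.norm.
rewrite /= sum_spectrum sum_abs -/(energy C _).
rewrite normrN normr_nat addr0 /gorder.
set E := energy C _; set S := \sum_(x <- s) x.
set n := #|H|; set m := #|line_graph H|.
move=> Eabs ES.
have -> : E = 2%:R *+ m + S - 2%:R *+ n by rewrite -Eabs addrC addKr.
have -> : S = - 2%:R *+ n - - 2%:R *+ m by rewrite ES addrC addKr.
ring.
Qed.

End LineGraphSpectrum.

Local Close Scope ring_scope.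

Theorem theorem4p1 (C : numClosedFieldType) :
  (forall G : sgraph,
     (forall u v : G, adj u v -> 6 <= deg u + deg v) ->
     forall k : nat, 2 <= k ->
       property_rho C (iter_line k G) /\
       energy C (iter_line k G) =
         (4%:R * ((gorder (iter_line k G))%:R
                  - (gorder (iter_line k.-1 G))%:R))%R) /\
  (forall k : nat, 2 <= k ->
     forall G H : sgraph,
       (forall u v : G, adj u v -> 6 <= deg u + deg v) ->
       (forall u v : H, adj u v -> 6 <= deg u + deg v) ->
       gorder (iter_line k G) = gorder (iter_line k H) ->
       gorder (iter_line k.-1 G) = gorder (iter_line k.-1 H) ->
       equienergetic C (iter_line k G) (iter_line k H)).
Proof.
have rho_energy (G : sgraph) (k : nat) :
    (forall u v : G, adj u v -> 6 <= deg u + deg v) -> 2 <= k ->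
      property_rho C (iter_line k G) /\
      energy C (iter_line k G) =
        (4%:R * ((gorder (iter_line k G))%:R
                 - (gorder (iter_line k.-1 G))%:R))%R.
  case: k => [|[|k]] // deg6 _.
  (* Here the exponent is [k.+2]: the graph is the second line graph of [iter_line k G], which
     inherits the degree condition. *)
  exact: line_graph2_rho_energy (iter_line_deg_edge (k := k) deg6).
split=> [G deg6 k k2|k k2 G H G6 H6 eqk eqk1]; first exact: rho_energy.
split=> //; have [_ ->] := rho_energy G k G6 k2.
by have [_ ->] := rho_energy H k H6 k2; rewrite eqk eqk1.
Qed.
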